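(* Let $\mathsf{C}$ be a Markov category. The following hold for all objects and morphisms of the indicated types: (a) Right decomposition: if $f:A\to X\otimes Y_1\otimes Y_2$ displays $A\perp\!\!\!\perp(Y_1\otimes Y_2)\,|\,X$, then the marginal of $f$ on $X\otimes Y_1$ displays $A\perp\!\!\!\perp Y_1\,|\,X$. (b) Contraction: if $f:A\to X\otimes W\otimes Y$ displays $A\perp\!\!\!\perp Y\,|\,(W\otimes X)$ and the marginal of $f$ on $X\otimes W$ displays $A\perp\!\!\!\perp W\,|\,X$, then $f$ also displays $A\perp\!\!\!\perp(W\otimes Y)\,|\,X$. Moreover, if $\mathsf{C}$ has conditionals, then also: (c) Weak union: if $f:A\to X\otimes W\otimes Y$ displays $A\perp\!\!\!\perp(W\otimes Y)\,|\,X$, then it also displays $A\perp\!\!\!\perp Y\,|\,(W\otimes X)$.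
   Context: A Markov category is a symmetric monoidal category $(\mathsf{C},\otimes,I)$ with symmetry $\mathsf{swap}_{X,Y}:X\otimes Y\to Y\otimes X$, in which every object $X$ is equipped with morphisms $\mathsf{copy}_X:X\to X\otimes X$ and $\mathsf{del}_X:X\to I$ forming a commutative comonoid (coassociative, counital, cocommutative), such that: (i) $\mathsf{del}_{X\otimes Y}$ is $\mathsf{del}_X\otimes\mathsf{del}_Y$ followed by $I\otimes I\cong I$; (ii) $\mathsf{copy}_{X\otimes Y}$ is $\mathsf{copy}_X\otimes\mathsf{copy}_Y$ followed by the canonical isomorphism $(X\otimes X)\otimes(Y\otimes Y)\cong(X\otimes Y)\otimes(X\otimes Y)$ swapping the two middle factors; (iii) $\mathsf{del}_Y\circ f=\mathsf{del}_X$ for every $f:X\to Y$. Associators and unitors are suppressed in formulas. The marginal of a morphism on some of its output factors is obtained by composing with $\mathsf{del}$ on all the other output factors. A morphism $f:A\to X\otimes Y$ displays the conditional independence $A\perp\!\!\!\perp Y\,|\,X$ if there are $g:A\to X$ and $k:X\to Y$ such that $f=(\mathrm{id}_X\otimes k)\circ\mathsf{copy}_X\circ g$. When the output factors of a morphism appear in a different order, the condition is applied after reordering the outputs by symmetry isomorphisms (e.g. to the order $(W\otimes X)\otimes Y$ for $A\perp\!\!\!\perp Y\,|\,(W\otimes X)$). $\mathsf{C}$ has conditionals if for every $f:A\to X\otimes Y$ there is $f_{|X}:X\otimes A\to Y$ such that $f=(\mathrm{id}_X\otimes f_{|X})\circ(\mathsf{copy}_X\otimes\mathrm{id}_A)\circ(f_X\otimes\mathrm{id}_A)\circ\mathsf{copy}_A$,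 where $f_X:=(\mathrm{id}_X\otimes\mathsf{del}_Y)\circ f:A\to X$. *)

(* Defs.v *)
Set Implicit Arguments.
Unset Strict Implicit.
Unset Printing Implicit Defensive.

Declare Scope markov_scope.
Delimit Scope markov_scope with markov.
Open Scope markov_scope.

Reserved Notation "X ~> Y" (at level 70, no associativity).
Reserved Notation "g ∘ f" (at level 40, left associativity).
Reserved Notation "X ⊗ Y" (at level 33, left associativity).
Reserved Notation "f ⊗ₘ g" (at level 33, left associativity).

Record Category : Type := {
  Ob :> Type;
  Hom : Ob -> Ob -> Type;
  id_hom : forall X, Hom X X;
  comp : forall X Y Z, Hom Y Z -> Hom X Y -> Hom X Z;
  comp_id_left : forall X Y (f : Hom X Y), comp (id_hom Y) f = f;
  comp_id_right : forall X Y (f : Hom X Y), comp f (id_hom X) = f;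
  comp_assoc : forall X Y Z W (h : Hom Z W) (g : Hom Y Z) (f : Hom X Y),
    comp h (comp g f) = comp (comp h g) f
}.

Arguments id_hom {c} X.

Notation "X ~> Y" := (Hom X Y) : markov_scope.
Notation "g ∘ f" := (comp g f) : markov_scope.

Record MonoidalData : Type := {
  base_category :> Category;
  tensor : base_category -> base_category -> base_category;
  tensor_hom : forall X X' Y Y' : base_category,
    (X ~> X') -> (Y ~> Y') -> (tensor X Y ~> tensor X' Y');
  unit_ob : base_category;
  assoc : forall X Y Z, tensor (tensor X Y) Z ~> tensor X (tensor Y Z);
  assoc_inv : forall X Y Z, tensor X (tensor Y Z) ~> tensor (tensor X Y) Z;
  lunit : forall X, tensor unit_ob X ~> X;
  lunit_inv : forall X, X ~> tensor unit_ob X;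
  runit : forall X, tensor X unit_ob ~> X;
  runit_inv : forall X, X ~> tensor X unit_ob;
  swap : forall X Y, tensor X Y ~> tensor Y X
}.

Arguments unit_ob {m}.
Arguments assoc {m} X Y Z.
Arguments assoc_inv {m} X Y Z.
Arguments lunit {m} X.
Arguments lunit_inv {m} X.
Arguments runit {m} X.
Arguments runit_inv {m} X.
Arguments swap {m} X Y.

Notation "X ⊗ Y" := (tensor X Y) : markov_scope.
Notation "f ⊗ₘ g" := (tensor_hom f g) : markov_scope.

Record SymmetricMonoidalCategory : Type := {
  monoidal_data :> MonoidalData;

  tensor_id : forall X Y : monoidal_data,
    id_hom X ⊗ₘ id_hom Y = id_hom (X ⊗ Y);
  tensor_comp : forall (X X' X'' Y Y' Y'' : monoidal_data)
      (f' : X' ~> X'') (f : X ~> X') (g' : Y' ~> Y'') (g : Y ~> Y'),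
    (f' ∘ f) ⊗ₘ (g' ∘ g) = (f' ⊗ₘ g') ∘ (f ⊗ₘ g);

  assocK : forall X Y Z : monoidal_data,
    assoc_inv X Y Z ∘ assoc X Y Z = id_hom ((X ⊗ Y) ⊗ Z);
  assoc_invK : forall X Y Z : monoidal_data,
    assoc X Y Z ∘ assoc_inv X Y Z = id_hom (X ⊗ (Y ⊗ Z));
  assoc_natural : forall (X X' Y Y' Z Z' : monoidal_data)
      (f : X ~> X') (g : Y ~> Y') (h : Z ~> Z'),
    assoc X' Y' Z' ∘ ((f ⊗ₘ g) ⊗ₘ h) = (f ⊗ₘ (g ⊗ₘ h)) ∘ assoc X Y Z;

  lunitK : forall X : monoidal_data,
    lunit_inv X ∘ lunit X = id_hom (unit_ob ⊗ X);
  lunit_invK : forall X : monoidal_data, lunit X ∘ lunit_inv X = id_hom X;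
  lunit_natural : forall (X Y : monoidal_data) (f : X ~> Y),
    lunit Y ∘ (id_hom unit_ob ⊗ₘ f) = f ∘ lunit X;

  runitK : forall X : monoidal_data,
    runit_inv X ∘ runit X = id_hom (X ⊗ unit_ob);
  runit_invK : forall X : monoidal_data, runit X ∘ runit_inv X = id_hom X;
  runit_natural : forall (X Y : monoidal_data) (f : X ~> Y),
    runit Y ∘ (f ⊗ₘ id_hom unit_ob) = f ∘ runit X;

  pentagon : forall X Y Z W : monoidal_data,
    assoc X Y (Z ⊗ W) ∘ assoc (X ⊗ Y) Z W
    = (id_hom X ⊗ₘ assoc Y Z W)
        ∘ assoc X (Y ⊗ Z) W ∘ (assoc X Y Z ⊗ₘ id_hom W);
  triangle : forall X Y : monoidal_data,
    (id_hom X ⊗ₘ lunit Y) ∘ assoc X unit_ob Y = runit X ⊗ₘ id_hom Y;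

  swap_natural : forall (X X' Y Y' : monoidal_data) (f : X ~> X') (g : Y ~> Y'),
    swap X' Y' ∘ (f ⊗ₘ g) = (g ⊗ₘ f) ∘ swap X Y;
  swapK : forall X Y : monoidal_data, swap Y X ∘ swap X Y = id_hom (X ⊗ Y);
  hexagon : forall X Y Z : monoidal_data,
    assoc Y Z X ∘ swap X (Y ⊗ Z) ∘ assoc X Y Z
    = (id_hom Y ⊗ₘ swap X Z) ∘ assoc Y X Z ∘ (swap X Y ⊗ₘ id_hom Z)
}.

(* The canonical isomorphism swapping the two middle factors. *)
Definition interchange (C : SymmetricMonoidalCategory) (X X' Y Y' : C) :
    (X ⊗ X') ⊗ (Y ⊗ Y') ~> (X ⊗ Y) ⊗ (X' ⊗ Y') :=
  assoc_inv X Y (X' ⊗ Y')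
    ∘ (id_hom X ⊗ₘ (assoc Y X' Y'
                     ∘ (swap X' Y ⊗ₘ id_hom Y')
                     ∘ assoc_inv X' Y Y'))
    ∘ assoc X X' (Y ⊗ Y').

Arguments interchange {C} X X' Y Y'.

Record MarkovCategory : Type := {
  smc :> SymmetricMonoidalCategory;

  copy : forall X : smc, X ~> X ⊗ X;
  del : forall X : smc, X ~> unit_ob;

  copy_coassoc : forall X : smc,
    assoc X X X ∘ (copy X ⊗ₘ id_hom X) ∘ copy X
    = (id_hom X ⊗ₘ copy X) ∘ copy X;
  copy_counit_left : forall X : smc,
    lunit X ∘ (del X ⊗ₘ id_hom X) ∘ copy X = id_hom X;
  copy_counit_right : forall X : smc,
    runit X ∘ (id_hom X ⊗ₘ del X) ∘ copy X = id_hom X;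
  copy_cocomm : forall X : smc, swap X X ∘ copy X = copy X;

  del_tensor : forall X Y : smc,
    del (X ⊗ Y) = lunit unit_ob ∘ (del X ⊗ₘ del Y);
  copy_tensor : forall X Y : smc,
    copy (X ⊗ Y) = interchange X X Y Y ∘ (copy X ⊗ₘ copy Y);
  del_natural : forall (X Y : smc) (f : X ~> Y), del Y ∘ f = del X
}.

Arguments copy {m} X.
Arguments del {m} X.

Definition marginal_fst (C : MarkovCategory) (A X Y : C) (f : A ~> X ⊗ Y) :
    A ~> X :=
  runit X ∘ (id_hom X ⊗ₘ del Y) ∘ f.

(* Outputs in another order or bracketing, e.g. [(X ⊗ W) ⊗ Y] read as
   [X ⊗ (W ⊗ Y)] or [(W ⊗ X) ⊗ Y], are first rearranged by composing [f] with
   the corresponding [assoc] or [swap]. *)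
Definition displays_ci (C : MarkovCategory) (A X Y : C) (f : A ~> X ⊗ Y) :
    Prop :=
  exists (g : A ~> X) (k : X ~> Y), f = (id_hom X ⊗ₘ k) ∘ copy X ∘ g.

Definition has_conditionals (C : MarkovCategory) : Prop :=
  forall (A X Y : C) (f : A ~> X ⊗ Y),
  exists f_X : X ⊗ A ~> Y,
    f = (id_hom X ⊗ₘ f_X)
          ∘ assoc X X A
          ∘ (copy X ⊗ₘ id_hom A)
          ∘ (marginal_fst f ⊗ₘ id_hom A)
          ∘ copy A.

(* Main.v *)
(* A displayed independence A ⟂ Y | (W ⊗ X) whose marginal on X ⊗ W displays
   A ⟂ W | X is generated by copying X and then W, so pulling one copy of X to
   the front (coassociativity) leaves a single kernel X → W ⊗ Y, which is the
   generic form of a kernel factored by its conditional on W.  Read from left to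
   right this is contraction, and read from right to left, for a kernel factored
   by a conditional, it is weak union. *)
From Corelib Require Import ssreflect ssrfun.
Require Import Defs.

Set Implicit Arguments.
Unset Strict Implicit.
Unset Printing Implicit Defensive.

(** Composites are kept right-nested; in this form an equation between pairs of arrows rewrites in
    the middle of such a chain. *)
Lemma precomp (C : Category) (X Y Y' Z : C) (g : Y ~> Z) (f : X ~> Y)
    (g' : Y' ~> Z) (f' : X ~> Y') :
  g ∘ f = g' ∘ f' -> forall V (x : V ~> X), g ∘ (f ∘ x) = g' ∘ (f' ∘ x).
Proof. by move=> e V x; rewrite comp_assoc e -comp_assoc. Qed.

Lemma precomp1 (C : Category) (X Y Z : C) (g : Y ~> Z) (f : X ~> Y) (h : X ~> Z) :
  g ∘ f = h -> forall V (x : V ~> X), g ∘ (f ∘ x) = h ∘ x.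
Proof. by move=> e V x; rewrite comp_assoc e. Qed.

Section SymmetricMonoidal.
Variable C : SymmetricMonoidalCategory.
Implicit Types X Y Z U V W A : C.

Lemma tensor_compl X X' X'' Y (f' : X' ~> X'') (f : X ~> X') :
  (f' ∘ f) ⊗ₘ id_hom Y = (f' ⊗ₘ id_hom Y) ∘ (f ⊗ₘ id_hom Y).
Proof. by rewrite -tensor_comp comp_id_left. Qed.

Lemma tensor_compr X Y Y' Y'' (g' : Y' ~> Y'') (g : Y ~> Y') :
  id_hom X ⊗ₘ (g' ∘ g) = (id_hom X ⊗ₘ g') ∘ (id_hom X ⊗ₘ g).
Proof. by rewrite -tensor_comp comp_id_left. Qed.

Lemma tensor_splitl X X' Y Y' (f : X ~> X') (g : Y ~> Y') :
  f ⊗ₘ g = (f ⊗ₘ id_hom Y') ∘ (id_hom X ⊗ₘ g).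
Proof. by rewrite -tensor_comp comp_id_left comp_id_right. Qed.

Lemma tensor_splitr X X' Y Y' (f : X ~> X') (g : Y ~> Y') :
  f ⊗ₘ g = (id_hom X' ⊗ₘ g) ∘ (f ⊗ₘ id_hom Y).
Proof. by rewrite -tensor_comp comp_id_left comp_id_right. Qed.

Lemma assoc_inv_natural X X' Y Y' Z Z' (f : X ~> X') (g : Y ~> Y') (h : Z ~> Z') :
  assoc_inv X' Y' Z' ∘ (f ⊗ₘ (g ⊗ₘ h)) = ((f ⊗ₘ g) ⊗ₘ h) ∘ assoc_inv X Y Z.
Proof.
rewrite -[X in X ∘ assoc_inv _ _ _]comp_id_left -assocK -!comp_assoc.
by rewrite (precomp (assoc_natural f g h)) assoc_invK comp_id_right.
Qed.

Lemma assoc_epi X Y Z V (f g : X ⊗ (Y ⊗ Z) ~> V) :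
  f ∘ assoc X Y Z = g ∘ assoc X Y Z -> f = g.
Proof.
move=> e; rewrite -[f]comp_id_right -[g]comp_id_right -!assoc_invK.
by rewrite !comp_assoc e.
Qed.

Lemma assoc_mono X Y Z V (f g : V ~> (X ⊗ Y) ⊗ Z) :
  assoc X Y Z ∘ f = assoc X Y Z ∘ g -> f = g.
Proof.
move=> e; rewrite -[f]comp_id_left -[g]comp_id_left -!assocK.
by rewrite -!comp_assoc e.
Qed.

(** The right unitor is a natural isomorphism, so tensoring with [unit_ob] is isomorphic to the
    identity functor. *)
Lemma tensor_unit_faithful X Y (f g : X ~> Y) :
  f ⊗ₘ id_hom unit_ob = g ⊗ₘ id_hom unit_ob -> f = g.
Proof.
move=> e; rewrite -[f]comp_id_right -[g]comp_id_right -!runit_invK.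
by rewrite !comp_assoc -!runit_natural e.
Qed.

(** Kelly's argument: after tensoring with [unit_ob], the claim follows from the pentagon with two
    unit factors and the triangle. *)
Lemma runit_tensor X Y :
  runit (X ⊗ Y) = (id_hom X ⊗ₘ runit Y) ∘ assoc X Y unit_ob.
Proof.
apply: tensor_unit_faithful; apply: assoc_mono.
rewrite -triangle comp_assoc -tensor_id assoc_natural -comp_assoc pentagon.
rewrite !comp_assoc -!tensor_compr triangle.
by rewrite -assoc_natural tensor_compl !comp_assoc.
Qed.

(** This is the inner part of [interchange], isolated so that passages across several factors can be
    fused. *)
Definition slide V X Z : V ⊗ (X ⊗ Z) ~> X ⊗ (V ⊗ Z) :=
  assoc X V Z ∘ (swap V X ⊗ₘ id_hom Z) ∘ assoc_inv V X Z.

Lemma slide_natural V V' X X' Z Z' (f : V ~> V') (g : X ~> X') (h : Z ~> Z') :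
  slide V' X' Z' ∘ (f ⊗ₘ (g ⊗ₘ h)) = (g ⊗ₘ (f ⊗ₘ h)) ∘ slide V X Z.
Proof.
rewrite /slide -!comp_assoc assoc_inv_natural.
rewrite (precomp (g' := (g ⊗ₘ f) ⊗ₘ h) (f' := swap V X ⊗ₘ id_hom Z)).
  by rewrite -!tensor_comp swap_natural comp_id_left comp_id_right.
by rewrite (precomp (assoc_natural _ _ _)).
Qed.

(** The other hexagon: by [swapK] this arrow inverts [swap X (U ⊗ V)], which [hexagon]
    decomposes. *)
Lemma swap_tensor U V X :
  swap (U ⊗ V) X =
  assoc X U V ∘ ((swap U X ⊗ₘ id_hom V)
    ∘ (assoc_inv U X V ∘ ((id_hom U ⊗ₘ swap V X) ∘ assoc U V X))).
Proof.
have e : swap X (U ⊗ V) ∘ assoc X U V = assoc_inv U V X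
    ∘ ((id_hom U ⊗ₘ swap X V) ∘ (assoc U X V ∘ (swap X U ⊗ₘ id_hom V))).
  apply: assoc_mono; rewrite [RHS]comp_assoc assoc_invK comp_id_left.
  by rewrite !comp_assoc hexagon.
rewrite -[RHS]comp_id_left -swapK -!comp_assoc (precomp e) -!comp_assoc.
rewrite (precomp1 (esym (tensor_compl _ _ _))) swapK tensor_id comp_id_left.
rewrite (precomp1 (assoc_invK _ _ _)) comp_id_left.
rewrite (precomp1 (esym (tensor_compr _ _ _))) swapK tensor_id comp_id_left.
by rewrite assocK comp_id_right.
Qed.

Lemma pentagon_inv X Y Z W :
  (id_hom X ⊗ₘ assoc Y Z W) ∘ assoc X (Y ⊗ Z) W
  = assoc X Y (Z ⊗ W) ∘ (assoc (X ⊗ Y) Z W ∘ (assoc_inv X Y Z ⊗ₘ id_hom W)).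
Proof.
rewrite [RHS]comp_assoc pentagon -!comp_assoc -tensor_compl assoc_invK.
by rewrite tensor_id comp_id_right.
Qed.

Lemma slide_tensor U V X Z :
  slide U X (V ⊗ Z) ∘ ((id_hom U ⊗ₘ slide V X Z) ∘ assoc U V (X ⊗ Z))
  = (id_hom X ⊗ₘ assoc U V Z) ∘ slide (U ⊗ V) X Z.
Proof.
apply: (@assoc_epi (U ⊗ V) X Z).
rewrite /slide -!comp_assoc assocK comp_id_right pentagon.
rewrite swap_tensor !tensor_compl !tensor_compr -!comp_assoc.
have e : (id_hom U ⊗ₘ assoc_inv V X Z) ∘ (id_hom U ⊗ₘ assoc V X Z) = id_hom _.
  by rewrite -tensor_compr assocK tensor_id.
rewrite (precomp1 e) comp_id_left.
rewrite -(precomp (assoc_natural _ _ _)) (precomp (pentagon_inv _ _ _ _)).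
rewrite (precomp1 (assocK _ _ _)) comp_id_left -!comp_assoc -tensor_id.
rewrite -(precomp (assoc_natural _ _ _)) [LHS]comp_assoc pentagon.
by rewrite -!comp_assoc.
Qed.

End SymmetricMonoidal.

Section Markov.
Variable C : MarkovCategory.
Implicit Types X Y Z U V W A : C.

Lemma swap_id_tensor_copy X Y (h : X ~> Y) :
  swap X Y ∘ ((id_hom X ⊗ₘ h) ∘ copy X) = (h ⊗ₘ id_hom X) ∘ copy X.
Proof. by rewrite comp_assoc swap_natural -comp_assoc copy_cocomm. Qed.

(** Naturality of [del] discards [k] and the counit law removes the copy. Hence the first stage of a
    display is determined by the displayed morphism. *)
Lemma marginal_fst_comp A X Y (k : X ~> Y) (g : A ~> X) :
  marginal_fst ((id_hom X ⊗ₘ k) ∘ copy X ∘ g) = g.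
Proof.
rewrite /marginal_fst !comp_assoc -[_ ∘ (_ ⊗ₘ k)]comp_assoc -tensor_compr.
by rewrite del_natural copy_counit_right comp_id_left.
Qed.

Lemma marginal_fst_post A X X' Y (s : X ~> X') (f : A ~> X ⊗ Y) :
  marginal_fst ((s ⊗ₘ id_hom Y) ∘ f) = s ∘ marginal_fst f.
Proof.
rewrite /marginal_fst -!comp_assoc (precomp1 (esym (tensor_comp _ _ _ _))).
rewrite comp_id_left comp_id_right tensor_splitl -comp_assoc.
by rewrite (precomp (runit_natural s)).
Qed.

Lemma marginal_fst_assoc A X Y Z (f : A ~> (X ⊗ Y) ⊗ Z) :
  marginal_fst f
  = (id_hom X ⊗ₘ (runit Y ∘ (id_hom Y ⊗ₘ del Z))) ∘ (assoc X Y Z ∘ f).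
Proof.
rewrite /marginal_fst runit_tensor tensor_compr -!comp_assoc -tensor_id.
by rewrite (precomp (assoc_natural _ _ _)).
Qed.

(** Coassociativity brings the two exchanged copies together, and cocommutativity absorbs their
    swap. *)
Lemma slide_copy X :
  slide X X X ∘ ((id_hom X ⊗ₘ copy X) ∘ copy X) = (id_hom X ⊗ₘ copy X) ∘ copy X.
Proof.
rewrite -copy_coassoc /slide -!comp_assoc (precomp1 (assocK _ _ _)) comp_id_left.
by rewrite (precomp1 (esym (tensor_compl _ _ _))) copy_cocomm.
Qed.

(** By [copy_tensor], one copy of [X] crosses the two copies of [W] one after the other.
    [slide_tensor] fuses this into one slide, naturality moves it before [h], and [slide_copy]
    absorbs it. *)
Lemma copy_slide X W (h : X ~> W) :
  assoc X W (W ⊗ X) ∘ ((swap W X ⊗ₘ id_hom (W ⊗ X))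
    ∘ (copy (W ⊗ X) ∘ ((h ⊗ₘ id_hom X) ∘ copy X)))
  = (id_hom X ⊗ₘ (assoc W W X ∘ (((copy W ∘ h) ⊗ₘ id_hom X) ∘ copy X)))
    ∘ copy X.
Proof.
transitivity ((id_hom X ⊗ₘ assoc W W X)
   ∘ (slide (W ⊗ W) X X ∘ (((copy W ∘ h) ⊗ₘ copy X) ∘ copy X))).
  rewrite [in RHS]comp_assoc -slide_tensor /slide copy_tensor /interchange.
  by rewrite -!comp_assoc (precomp1 (esym (tensor_comp _ _ _ _))) comp_id_right.
rewrite tensor_compr -comp_assoc [_ ⊗ₘ copy X]tensor_splitl -tensor_id.
rewrite -[in LHS]comp_assoc (precomp (slide_natural _ _ _)) slide_copy.
by rewrite [in RHS]tensor_compr -!comp_assoc.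
Qed.

(** The kernel on the right has the shape found in [has_conditionals], with [h] as marginal and [k]
    as conditional. *)
Lemma iterated_copy X W Y (h : X ~> W) (k : W ⊗ X ~> Y) :
  assoc X W Y ∘ ((swap W X ⊗ₘ id_hom Y)
    ∘ ((id_hom (W ⊗ X) ⊗ₘ k)
       ∘ (copy (W ⊗ X) ∘ ((h ⊗ₘ id_hom X) ∘ copy X))))
  = (id_hom X ⊗ₘ ((id_hom W ⊗ₘ k)
       ∘ (assoc W W X ∘ (((copy W ∘ h) ⊗ₘ id_hom X) ∘ copy X))))
    ∘ copy X.
Proof.
rewrite tensor_compr -[RHS]comp_assoc -copy_slide.
rewrite [RHS](precomp (esym (assoc_natural _ _ _))) tensor_id.
by rewrite (precomp (etrans (esym (tensor_splitl _ k)) (tensor_splitr _ k))).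
Qed.

End Markov.

Theorem proposition12p20 (C : MarkovCategory) :
  (* (a) right decomposition *)
  (forall (A X Y1 Y2 : C) (f : A ~> (X ⊗ Y1) ⊗ Y2),
     displays_ci (assoc X Y1 Y2 ∘ f) ->
     displays_ci (marginal_fst f)) /\
  (* (b) contraction *)
  (forall (A X W Y : C) (f : A ~> (X ⊗ W) ⊗ Y),
     displays_ci ((swap X W ⊗ₘ id_hom Y) ∘ f) ->
     displays_ci (marginal_fst f) ->
     displays_ci (assoc X W Y ∘ f)) /\
  (* (c) weak union *)
  (has_conditionals C ->
   forall (A X W Y : C) (f : A ~> (X ⊗ W) ⊗ Y),
     displays_ci (assoc X W Y ∘ f) ->
     displays_ci ((swap X W ⊗ₘ id_hom Y) ∘ f)).
Proof.
have swapT (X W Y : C) : (swap W X ⊗ₘ id_hom Y) ∘ (swap X W ⊗ₘ id_hom Y)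
    = id_hom ((X ⊗ W) ⊗ Y) by rewrite -tensor_compl swapK tensor_id.
split; [|split].
(* Discarding [Y2] affects only the kernel, so the marginal of [k] is the new kernel. *)
- move=> A X Y1 Y2 f [g [k e]]; exists g, (marginal_fst k).
  by rewrite marginal_fst_assoc e !comp_assoc -tensor_compr.
- move=> A X W Y f [g [k ef]] [e [h em]].
  (* Taking marginals in both displays forces [g]: up to a swap it is the marginal of [f], which
     [em] factors through [e]. *)
  have eg : g = ((h ⊗ₘ id_hom X) ∘ copy X) ∘ e.
    rewrite -swap_id_tensor_copy -comp_assoc -em -marginal_fst_post ef.
    by rewrite marginal_fst_comp.
  (* The kernel is left open and read off from the right-hand side of [iterated_copy]. *)
  exists e; eexists.
  apply: etrans (congr1 (fun m => m ∘ e) (iterated_copy h k)).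
  have ef' : (id_hom (W ⊗ X) ⊗ₘ k)
      ∘ (copy (W ⊗ X) ∘ (((h ⊗ₘ id_hom X) ∘ copy X) ∘ e))
      = (swap X W ⊗ₘ id_hom Y) ∘ f by rewrite ef eg -!comp_assoc.
  rewrite -!comp_assoc in ef' *.
  by rewrite ef' (precomp1 (swapT _ _ _)) comp_id_left.
(* The conditional is taken of the kernel [k] rather than of [f], so that [c] has source [W ⊗ X] and
   does not see [A]. *)
- move=> cond A X W Y f [g [k ef]]; have [c ek] := cond _ _ _ k.
  exists ((marginal_fst k ⊗ₘ id_hom X) ∘ copy X ∘ g), c.
  have e := iterated_copy (marginal_fst k) c.
  rewrite tensor_compl -!comp_assoc in e ek; rewrite -ek in e.
  have {}e : f = (swap W X ⊗ₘ id_hom Y) ∘ ((id_hom (W ⊗ X) ⊗ₘ c)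
      ∘ (copy (W ⊗ X) ∘ (((marginal_fst k ⊗ₘ id_hom X) ∘ copy X) ∘ g))).
    by apply: assoc_mono; rewrite ef -e -!comp_assoc.
  by rewrite e (precomp1 (swapT _ _ _)) comp_id_left -!comp_assoc.
Qed.
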